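(* Let $\psi:[0,\infty)\to[0,\infty)$ be an absolutely continuous, strictly increasing function with $\psi(0)=0$. Let $\Psi,T:[0,\infty)\to[0,\infty)$ be the functions with $\Psi(0)=T(0)=0$, $\Psi'\equiv\psi$ and $T'\equiv\Psi$. Let $N$ be a positive integer. Then $$\inf_{\#\mathcal P=N}\|D_{\mathcal P}\|_\psi=\inf\left\{K>0:2K\,\Psi\left(\frac1{2K}\right)\leq 1\right\}$$ and $$\inf_{\#\mathcal P=N}\|\widetilde D_{\mathcal P}\|_\psi=\inf\left\{K>0:2K^2\,T\left(\frac1K\right)\leq 1\right\},$$ where the infima on the left-hand sides are extended over all $N$-element point sets $\mathcal P\subset[0,1]$.
   Context: For an $N$-element point set $\mathcal P=\{x_0,\ldots,x_{N-1}\}\subset[0,1]$, the one-parameter discrepancy function is $D_{\mathcal P}(t)=\sum_{n=0}^{N-1}\mathbf 1_{[0,t)}(x_n)-Nt$ for $t\in[0,1]$ ($\mathbf 1_A$ is the indicator function of $A$). The two-parameter discrepancy function is considered on all of $[0,1]^2$ and given by $\widetilde D_{\mathcal P}(t_1,t_2)=D_{\mathcal P}(t_2)-D_{\mathcal P}(t_1)$, which for $t_1\leq t_2$ equals $\sum_{n=0}^{N-1}\mathbf 1_{[t_1,t_2)}(x_n)-N(t_2-t_1)$. For a measurable $f:A\to\mathbb R$ with $A\subseteq\mathbb R^d$ of Lebesgue measure $1$, $$\|f\|_\psi:=\inf\left\{K>0:\int_A\psi\left(\frac{|f(t)|}{K}\right)dt\leq 1\right\},$$ with $\inf\emptyset=\infty$;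 here $A=[0,1]$ for $D_{\mathcal P}$ and $A=[0,1]^2$ for $\widetilde D_{\mathcal P}$. Absolutely continuous means absolutely continuous on every bounded interval $[0,a]$, so that $\psi$ is differentiable almost everywhere and $\psi(a)=\int_0^a\psi'(s)\,ds$ for all $a\geq 0$. *)

(* Defs.v *)
From HB Require Import structures.
From mathcomp Require Import all_boot all_order all_algebra finmap.
From mathcomp Require Import all_classical all_reals all_analysis.

Set Implicit Arguments.
Unset Strict Implicit.
Unset Printing Implicit Defensive.

Import Order.TTheory GRing.Theory Num.Theory.
Import numFieldNormedType.Exports.

Local Open Scope classical_set_scope.
Local Open Scope ring_scope.

(* Functions on [0, +oo) are represented by functions R -> R; no definition
   below depends on their values at negative arguments. *)

(* The subintervals I_i = ](I i).1, (I i).2[ may be degenerate, which does not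
   change the notion. *)
Definition abs_continuous_on (R : realType) (a b : R) (f : R -> R) : Prop :=
  forall e : R, 0 < e -> exists2 d : R, 0 < d &
    forall (n : nat) (I : 'I_n -> R * R),
      (forall i, [/\ a <= (I i).1, (I i).1 <= (I i).2 & (I i).2 <= b]) ->
      trivIset setT (fun i => `](I i).1, (I i).2[%classic) ->
      \sum_(i < n) ((I i).2 - (I i).1) < d ->
      \sum_(i < n) `|f (I i).2 - f (I i).1| < e.

(* F' = f on [0, +oo), the derivative at 0 being the right derivative. *)
Definition has_derivative_nonneg (R : realType) (F f : R -> R) : Prop :=
  (forall x : R, 0 < x -> is_derive x 1 F (f x)) /\
  (F h - F 0) / h @[h --> 0^'+] --> f 0.

Definition discrepancy (R : realType) (P : {fset R}) (t : R) : R :=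
  \sum_(x <- P) \1_`[0, t[%classic x - #|` P|%:R * t.

Definition discrepancy2 (R : realType) (P : {fset R}) (t : R * R) : R :=
  discrepancy P t.2 - discrepancy P t.1.

Definition point_sets (R : realType) (N : nat) : set {fset R} :=
  [set P : {fset R} | #|` P| = N /\ [set` P] `<=` `[0, 1]%classic].

(* ereal_inf set0 = +oo, the convention required for the infimum. *)
Definition psi_norm d (T : measurableType d) (R : realType)
    (mu : set T -> \bar R) (A : set T) (psi : R -> R) (f : T -> R) : \bar R :=
  ereal_inf [set K%:E | K in
    [set K : R | 0 < K /\ (\int[mu]_(t in A) (psi (`|f t| / K))%:E <= 1)%E]].

(* Main.v *)
Require Import Defs.
From HB Require Import structures.
From mathcomp Require Import all_boot all_order all_algebra finmap.
From mathcomp Require Import all_classical all_reals all_analysis.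
From mathcomp Require Import measurable_realfun ring lra.

Set Implicit Arguments.
Unset Strict Implicit.
Unset Printing Implicit Defensive.

Import Order.TTheory GRing.Theory Num.Theory.
Import numFieldNormedType.Exports.

Local Open Scope classical_set_scope.
Local Open Scope ring_scope.

(** Write U for the uniform law on [0, 1], and fix a point set P with N points.

    For t uniform, the value D_P(t) is an integer minus N t, so modulo 1 it is
    uniform; hence the law of D_P has a density bounded by 1
    ([discrepancy_density]), that is, its distribution function F is
    1-Lipschitz. As F is continuous, F(D_P(t)) is again uniform
    ([integral_rcdf_comp]). So D_P is, up to the contraction F, a uniform
    variable: with s, t independent, |F(D_P(t)) - F(D_P(s))| is at most
    |D_P(t) - D_P(s)| and has the law of |q - p| for p, q independent and
    uniform. Since psi is nondecreasing, the integral of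
    psi(|D_P(t) - D_P(s)| / K) is at least that of psi(|q - p| / K), for every
    K at once ([integral2_ge_uniform]). The same argument applied to the
    nonnegative variable |D_P|, whose distribution function G is 2-Lipschitz
    with G(0) = 0, bounds the integral of psi(|D_P| / K) below by that of
    psi(p / (2 K)) ([integral_ge_uniform]).

    Both bounds are attained simultaneously for all K by the centered points
    (i + 1/2) / N. There D_P takes its values in [-1/2, 1/2]
    ([discrepancy_centered_points]), and a 1-Lipschitz distribution function
    that climbs from 0 to 1 over an interval of length 1 has to be affine on
    it ([rcdf_affine]); so F is then an isometry on the values of D_P, and the
    inequalities become equalities.

    The extremal integrals are elementary: the first is 2 K Psi(1 / (2 K)), the
    second 2 K^2 T(1 / K), by the fundamental theorem of calculus applied once
    and twice ([integral_uniform_dist0], [integral2_uniform_dist]). The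
    inner integral in the second runs over q - p of both signs, which is why
    Psi and T are extended to odd functions on the line: their derivatives are
    then psi(|x|) and Psi(|x|) everywhere, across the diagonal p = q as well.

    Since the bounds hold for each K separately and one point set attains them
    all, the sublevel conditions defining the norms compare, and taking infima
    gives both identities ([ereal_inf_level_attained]). *)

(** * Odd extensions and the fundamental theorem of calculus *)

(** A single interval in the definition of absolute continuity already gives
    continuity. *)
Lemma even_continuous (R : realType) (f : R -> R) :
  (forall a, 0 <= a -> abs_continuous_on 0 a f) ->
  continuous (fun x : R => f `|x|).
Proof.
move=> ac x; apply/cvgrPdist_lt => e e0.
have [d d0 {}ac] := ac (`|x| + 1) (addr_ge0 (normr_ge0 _) ler01) e e0.
(* Absolute continuity of f on [0, |x| + 1] covers a neighborhood of |x|. *)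
have step u v : 0 <= u -> u <= v -> v <= `|x| + 1 -> v - u < d ->
    `|f v - f u| < e.
  move=> u0 uv vx vud; have := ac 1%N (fun=> (u, v)); rewrite !big_ord1/=.
  apply=> //.
  by apply/trivIsetP => i j _ _; rewrite !ord1.
near=> y.
have xy : `|x - y| < Num.min 1 d.
  by near: y; apply/nbhs_ballP; exists (Num.min 1 d); rewrite //= lt_min ltr01.
move: xy; rewrite lt_min => /andP[xy1 xyd].
have := ler_dist_dist x y; set u := `|x|; set v := `|y| => uv.
have [vu|uv'] := leP v u.
  apply: step; rewrite /u /v//; first lra.
  by apply: le_lt_trans xyd; apply: le_trans uv; rewrite ler_norm.
rewrite distrC; apply: step; rewrite /u /v//; first exact: ltW.
  have := lerB_dist y x; rewrite distrC -/u -/v => ?; lra.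
by apply: le_lt_trans xyd; apply: le_trans uv; rewrite distrC ler_norm.
Unshelve. all: by end_near. Qed.

Definition odd_extension (R : realType) (F : R -> R) (x : R) : R :=
  Num.sg x * F `|x|.

(** At 0 the two one-sided difference quotients of an odd function agree, so
    a right derivative at 0 becomes a two-sided one. *)
Lemma is_derive_odd_extension (R : realType) (F f : R -> R) :
  F 0 = 0 -> has_derivative_nonneg F f ->
  forall x : R, is_derive x 1 (odd_extension F) (f `|x|).
Proof.
move=> F0 [dF dF0] x; have [x0|x0|->] := ltgtP x 0.
  apply: (@near_eq_is_derive _ _ _ (fun y => - F (- y))).
    near=> y; have y0 : y < 0 by near: y; exact: lt_nbhsl.
    by rewrite /odd_extension ltr0_sg// ltr0_norm// mulN1r.
  rewrite ltr0_norm//.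
  have dFx : is_derive (- x) 1 F (f (- x)) by apply: dF; rewrite oppr_gt0.
  have H := @is_derive1_comp _ F -%R x (f (- x)) (-1) dFx _.
  apply: is_derive_eq.
  by rewrite mulrN1 opprK.
- apply: (@near_eq_is_derive _ _ _ F).
    near=> y; have y0 : 0 < y by near: y; exact: lt_nbhsr.
    by rewrite /odd_extension gtr0_sg// gtr0_norm// mul1r.
  by rewrite gtr0_norm//; exact: dF.
- rewrite normr0.
  have H : (fun h => h^-1 *: ((odd_extension F \o shift 0) (h *: 1)
              - odd_extension F 0)) @ 0^' --> f 0.
    apply/cvgrPdist_lt => e e0.
    have /cvgrPdist_lt/(_ _ e0) := dF0; rewrite near_withinE => -[d/= d0 dH].
    rewrite near_withinE.
    exists d => //= h hd h0.
    have := dH `|h|; rewrite /ball_/= sub0r normrN normr_id.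
    move: hd; rewrite /ball_/= sub0r normrN => hd /(_ hd); rewrite normr_gt0 => /(_ h0).
    rewrite F0 subr0 /odd_extension sgr0 mul0r subr0 /= addr0 scaler1.
    suff -> : h^-1 *: (Num.sg h * F `|h|) = F `|h| / `|h| by [].
    by rewrite [X in _ = _ / X]normrEsg invfM invr_sg /GRing.scale/=; ring.
  apply: DeriveDef; first by apply/cvg_ex; exists (f 0).
  exact: cvg_lim H.
Unshelve. all: by end_near. Qed.

Lemma integral_derivative (R : realType) (F f : R -> R) (a b : R) :
  a < b -> continuous f -> (forall x : R, is_derive x 1 F (f x)) ->
  (\int[lebesgue_measure]_(x in `[a, b]) (f x)%:E = (F b - F a)%:E)%E.
Proof.
move=> ab cf dF.
have cF : continuous F.
  by move=> x; apply/differentiable_continuous/derivable1_diffP; case: (dF x).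
rewrite (@continuous_FTC2 _ _ F)// ?EFinB//.
- exact: continuous_subspaceT.
- split; first by move=> x _; case: (dF x).
  + exact/cvg_at_right_filter/cF.
  + exact/cvg_at_left_filter/cF.
- by move=> x _; rewrite derive1E; case: (dF x).
Qed.

Lemma is_derive_affine (R : realType) (F f : R -> R) (a b c : R) :
  (forall x : R, is_derive x 1 F (f x)) ->
  forall x : R, is_derive x 1 (fun y => c * F (a * y + b)) (c * (a * f (a * x + b))).
Proof.
move=> dF x.
have dg : is_derive x 1 (fun y : R => a * y + b) a.
  by apply: is_derive_eq; rewrite scaler1 addr0.
have dFg := @is_derive1_comp _ F (fun y : R => a * y + b) x _ _ (dF _) dg.
apply: is_derive_eq.
by rewrite /GRing.scale/= [a * f _]mulrC.
Qed.

(** * The probability integral transform *)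

Section standard_uniform.
Variable R : realType.
Local Notation U := (@uniform_prob R 0 1 ltr01).

Lemma uniform_prob01E (A : set (measurableTypeR R)) : measurable A ->
  U A = lebesgue_measure (A `&` `[0, 1]).
Proof.
move=> mA; rewrite /uniform_prob integral_uniform_pdf.
rewrite (eq_integral (fun=> 1%E)) => [|x].
  by rewrite integral_cst ?mul1e//; exact: measurableI.
by rewrite inE/= in_itv/= /uniform_pdf => -[_ ->]; rewrite subr0 invr1.
Qed.

Lemma uniform_prob01_ray (p : R) : 0 <= p <= 1 -> U `]-oo, p] = p%:E.
Proof.
move=> /andP[p0 p1]; rewrite uniform_prob01E//.
rewrite (_ : _ `&` _ = `[0, p]%classic); last first.
  apply/seteqP; split=> x /=; rewrite !in_itv/=.
    by case=> -> /andP[->].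
  by move=> /andP[-> xp]; rewrite xp (le_trans xp p1).
rewrite lebesgue_measure_itv/= lte_fin oppr0 adde0.
by case: ltP => // p0'; congr _%:E; apply/le_anti; rewrite p0 p0'.
Qed.

(** On [0, 1] the normalizing factor of the uniform law is 1; this moves
    between its integrals and Lebesgue integrals. *)
Lemma integral_uniform01 (f : R -> \bar R) :
  measurable_fun setT f -> (forall x, 0 <= f x)%E ->
  (\int[U]_x f x = \int[lebesgue_measure]_(x in `[0%R, 1%R]) f x)%E.
Proof. by move=> mf f0; rewrite integral_uniform// subr0 invr1 mul1e. Qed.

End standard_uniform.

(** The rays ]x, +oo[ are closed under intersection and generate the Borel
    sets, so a probability is determined by its distribution function. *)
Lemma eq_probability_rays (R : realType)
    (P Q : probability (measurableTypeR R) R) :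
  (forall x : R, P `]-oo, x]%classic = Q `]-oo, x]%classic) ->
  forall A : set R, measurable A -> P A = Q A.
Proof.
move=> PQ; have PQ' x : P `]x, +oo[%classic = Q `]x, +oo[%classic.
  by rewrite -setCitvl !probability_setC// PQ.
apply: (@measure_unique _ _ (measurableTypeR R) (@RGenOInfty.G R)
  (fun k : nat => `]- k%:R, +oo[%classic) _ _ _ _ P Q).
- exact: RGenOInfty.measurableE.
- move=> _ _ [x ->] [y ->]; exists (Num.max x y).
  by apply/seteqP; split=> z /=; rewrite !in_itv/= !andbT gt_max => /andP.
- by move=> k; exists (- k%:R).
- apply/seteqP; split=> // x _; exists (Num.truncn `|x|).+1 => //=.
  by rewrite in_itv/= andbT ltrNl (le_lt_trans (ler_norm _))// normrN truncnS_gt.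
- by move=> _ [x ->]; exact: PQ'.
- by move=> k; apply: le_lt_trans (probability_le1 _ _) _; rewrite ?ltry.
Qed.

(** The rays ending at 0 and at 1 have mass 0 and 1, which fixes by monotonicity
    the mass of every ray ending outside [0, 1]. *)
Lemma eq_uniform_prob01 (R : realType)
    (P : probability (measurableTypeR R) R) :
  (forall p : R, 0 <= p <= 1 -> P `]-oo, p]%classic = p%:E) ->
  forall A : set R, measurable A -> P A = uniform_prob ltr01 A.
Proof.
move=> Pray; apply: eq_probability_rays => x.
suff ray (Q : probability (measurableTypeR R) R) :
    (forall p : R, 0 <= p <= 1 -> Q `]-oo, p]%classic = p%:E) ->
    Q `]-oo, x]%classic = (Num.max 0 (Num.min 1 x))%:E.
  by rewrite !ray//; exact: uniform_prob01_ray.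
move=> Qray; have Q_le (a b : R) : a <= b ->
    (Q `]-oo, a]%classic <= Q `]-oo, b]%classic)%E.
  by move=> ab; apply: le_measure; rewrite ?inE//; exact: subset_itvl.
have [x0|x0] := ltP x 0.
  rewrite min_r ?max_l; [|lra|lra]; apply/eqP.
  by rewrite eq_le measure_ge0 andbT -(Qray 0) ?lexx ?ler01// Q_le// ltW.
have [x1|x1] := leP x 1; first by rewrite max_r// Qray// x0.
rewrite max_r//; apply/eqP.
by rewrite eq_le probability_le1//= -(Qray 1) ?lexx ?ler01// Q_le// ltW.
Qed.


Section integral_transform.
Context d (T : measurableType d) (R : realType) (P : probability T R).
Variable X : {RV P >-> R}.
Local Notation U := (@uniform_prob R 0 1 ltr01).

Definition rcdf (r : R) : R := fine (cdf X r).

Lemma rcdfE r : cdf X r = (rcdf r)%:E.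
Proof. by rewrite /rcdf fineK// fin_num_measure. Qed.

Lemma rcdf_nondecreasing : {homo rcdf : x y / x <= y}.
Proof. by move=> x y xy; rewrite -lee_fin -!rcdfE cdf_nondecreasing. Qed.

Lemma rcdf_ge0 r : 0 <= rcdf r.
Proof. by rewrite -lee_fin -rcdfE cdf_ge0. Qed.

Lemma rcdf_le1 r : rcdf r <= 1.
Proof. by rewrite -lee_fin -rcdfE cdf_le1. Qed.

Lemma measurable_rcdf : measurable_fun [set: R] rcdf.
Proof. exact: nondecreasing_measurable rcdf_nondecreasing. Qed.

Lemma rcdf_onto (p : R) : continuous rcdf -> 0 < p < 1 -> exists v, rcdf v = p.
Proof.
move=> cF /andP[p0 p1].
have F0 : rcdf @ -oo --> (0 : R) by apply/fine_cvg; exact: cvg_cdfNy0.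
have F1 : rcdf @ +oo --> (1 : R) by apply/fine_cvg; exact: cvg_cdfy1.
have [a ap] : exists a, rcdf a < p.
  near (ninfty_nbhs R) => a; exists a; near: a.
  exact: (cvgr_lt 0 F0).
have [b pb] : exists b, p < rcdf b.
  near (pinfty_nbhs R) => b; exists b; near: b.
  exact: (cvgr_gt 1 F1).
have ab : a <= b.
  by rewrite leNgt; apply/negP => /ltW/rcdf_nondecreasing; rewrite leNgt (lt_trans ap pb).
have pab : Num.min (rcdf a) (rcdf b) <= p <= Num.max (rcdf a) (rcdf b).
  rewrite (min_idPl (rcdf_nondecreasing ab)) (max_idPr (rcdf_nondecreasing ab)).
  by rewrite !ltW.
have [c _ Fc] := IVT ab (continuous_subspaceT cF) pab.
by exists c.
Unshelve. all: by end_near. Qed.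

(** The codomain is the copy of the line that carries the Lebesgue measure and
    the uniform law, so that laws can be compared there. *)
Definition rcdf_comp : T -> measurableTypeR R := rcdf \o X.

Lemma measurable_rcdf_comp : measurable_fun [set: T] rcdf_comp.
Proof. by apply: (measurableT_comp measurable_rcdf); exact: measurable_funPT. Qed.

HB.instance Definition _ :=
  @isMeasurableFun.Build _ _ T (measurableTypeR R) rcdf_comp
    measurable_rcdf_comp.

(** If F v = p then the event X <= v implies F(X) <= p, whence one
    inequality. Conversely F(X) <= p < F v' implies X <= v', so the
    probability is at most F v', and F v' can be any value slightly above p. *)
Lemma rcdf_comp_ray (p : R) : continuous rcdf -> 0 <= p <= 1 ->
  distribution P rcdf_comp `]-oo, p]%classic = p%:E.
Proof.
move=> cF /andP[p0 p1].
have mle r : measurable [set t | rcdf (X t) <= r].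
  have := @measurable_funPTI _ _ _ _ rcdf_comp `]-oo, r]%classic.
  rewrite (_ : _ @^-1` _ = [set t | rcdf (X t) <= r]); last first.
    by apply/seteqP; split=> t /=; rewrite in_itv.
  exact.
have -> : distribution P rcdf_comp `]-oo, p]%classic
    = P [set t | rcdf (X t) <= p].
  by congr (P _); apply/seteqP; split=> t /=; rewrite in_itv.
have PX v : P [set t | X t <= v] = (rcdf v)%:E.
  by rewrite -rcdfE; congr (P _); apply/seteqP; split=> t /=; rewrite in_itv.
have mX v : measurable [set t | X t <= v].
  rewrite (_ : [set _ | _] = X @^-1` `]-oo, v]%classic).
    exact: measurable_funPTI.
  by apply/seteqP; split=> t /=; rewrite in_itv.
apply/eqP; rewrite eq_le; apply/andP; split.
  apply/lee_addgt0Pr => e e0; rewrite -EFinD.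
  have [pe|pe] := ltP (p + e) 1; last first.
    by apply: le_trans (probability_le1 _ _) _.
  have [v Fv] : exists v, rcdf v = p + e by apply: rcdf_onto => //; lra.
  rewrite -Fv -PX; apply: le_measure; rewrite ?inE// => t /=.
  move=> Ftp; rewrite leNgt; apply/negP => /ltW/rcdf_nondecreasing.
  by rewrite Fv => /le_trans/(_ Ftp); lra.
have [p_le0|{}p0] := leP p 0; first by have -> : p = 0 by lra.
have [{}p1|p_ge1] := ltP p 1; last first.
  have -> : p = 1 by lra.
  rewrite (_ : [set _ | _] = setT) ?probability_setT//.
  by apply/seteqP; split=> t //= _; exact: rcdf_le1.
have [v <-] : exists v, rcdf v = p by apply: rcdf_onto => //; lra.
rewrite -[leLHS]PX; apply: le_measure; rewrite ?inE// => t /=.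
exact: rcdf_nondecreasing.
Qed.

(** The probability integral transform: if F is the continuous distribution
    function of X, then F(X) is uniform on [0, 1]. *)
Lemma integral_rcdf_comp (f : R -> \bar R) : continuous rcdf ->
  measurable_fun setT f -> (forall x, 0 <= f x)%E ->
  (\int[P]_t f (rcdf (X t)) = \int[U]_x f x)%E.
Proof.
move=> cF mf f0.
rewrite -[LHS](@ge0_integral_distribution _ _ _ _ _ P rcdf_comp f)//.
apply: eq_measure_integral => A mA _.
by apply: eq_uniform_prob01 => // p; exact: rcdf_comp_ray.
Qed.

End integral_transform.

(** * Comparing a law of bounded density with the uniform law *)

Lemma probability1_ae d (T : measurableType d) (R : realType)
    (P : probability T R) (A : set T) (Q : T -> Prop) :
  measurable A -> P A = 1%E -> (forall t, A t -> Q t) -> {ae P, forall t, Q t}.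
Proof.
move=> mA PA AQ; exists (~` A); split; first exact: measurableC.
  by rewrite probability_setC// PA subee.
by move=> t; apply: contra_not; exact: AQ.
Qed.

Section bounded_density.
Context d (T : measurableType d) (R : realType) (P : probability T R).
Variables (X : {RV P >-> R}) (L : R).
Local Notation U := (@uniform_prob R 0 1 ltr01).
Local Notation F := (rcdf X).
Hypothesis L_gt0 : 0 < L.
Hypothesis density : forall u v : R, u <= v ->
  (P (X @^-1` `[u, v]) <= (L * (v - u))%:E)%E.

Let mX (i : interval R) : measurable (X @^-1` [set` i]).
Proof. by apply: measurable_funPTI; exact: measurable_itv. Qed.

Let PX_le v : P (X @^-1` `]-oo, v]) = (F v)%:E.
Proof. by rewrite -rcdfE. Qed.

Lemma rcdfB_le u v : u <= v -> F v - F u <= L * (v - u).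
Proof.
move=> uv; rewrite lerBlDl -lee_fin EFinD -!PX_le.
apply: le_trans (leeD2l _ (density uv)).
apply: le_trans (measureU2 _ _ _) => //.
apply: le_measure; rewrite ?inE//; first exact: measurableU.
move=> t /=; rewrite !in_itv/= => ->; rewrite andbT.
by apply/orP; exact: le_total.
Qed.

Lemma rcdf_lipschitz u v : `|F v - F u| <= L * `|v - u|.
Proof.
wlog uv : u v / u <= v => [wlg|].
  have [|/ltW] := leP u v; first exact: wlg.
  by rewrite (distrC (F v)) (distrC v); exact: wlg.
rewrite !ger0_norm ?subr_ge0//; first exact: rcdfB_le.
exact: rcdf_nondecreasing.
Qed.

Lemma rcdf_continuous : continuous F.
Proof.
move=> x; apply/cvgrPdist_lt => e e0; near=> y.
apply: le_lt_trans (rcdf_lipschitz _ _) _.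
rewrite -ltr_pdivlMl//; near: y; apply/nbhs_ballP.
by exists (L^-1 * e) => //=; rewrite mulr_gt0// invr_gt0.
Unshelve. all: by end_near. Qed.

(** The mass 1 of [a, b] is at most L (v - a) to the left of v and at most
    L (b - v) to the right, and these bounds add up to 1; so both are
    attained. *)
Lemma rcdf_affine a b v : L * (b - a) = 1 ->
  P (X @^-1` `[a, b]) = 1%E -> a <= v <= b -> F v = L * (v - a).
Proof.
move=> Lab Pab /andP[av vb].
have cover (i j : interval R) : `[a, b] `<=` [set` i] `|` [set` j] ->
    (1 <= P (X @^-1` [set` i]) + P (X @^-1` [set` j]))%E.
  move=> abij; rewrite -Pab; apply: le_trans (measureU2 _ _ _) => //.
  by apply: le_measure; rewrite ?inE//; [exact: measurableU|move=> t /abij].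
apply/le_anti/andP; split.
- have : (1 <= (L * (v - a))%:E + (1 - F v)%:E)%E.
    apply: le_trans (leeD2r _ (density av)).
    rewrite EFinB -PX_le -probability_setC// preimage_setC setCitvl.
    apply: cover => t /=; rewrite !in_itv/= andbT => /andP[-> _] /=.
    by case: (leP t v) => _; [left|right].
  by rewrite -EFinD lee_fin; lra.
- have : (1 <= (F v)%:E + (L * (b - v))%:E)%E.
    rewrite -PX_le; apply: le_trans (leeD2l _ (density vb)).
    apply: cover => t /=; rewrite !in_itv/= => /andP[_ ->].
    by rewrite andbT; apply/orP; exact: le_total.
  by rewrite -EFinD lee_fin -Lab; lra.
Qed.

Variable phi : R -> R.
Hypothesis phi_ge0 : forall x, 0 <= phi x.
Hypothesis phi_mono : forall x y, `|x| <= `|y| -> phi x <= phi y.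
Hypothesis mphi : measurable_fun [set: R] phi.

Let mphiX : measurable_fun [set: T] (fun t => (phi (X t))%:E).
Proof.
by apply/measurable_EFinP; apply: measurableT_comp => //; exact: measurable_funPT.
Qed.

Let mphiL : measurable_fun [set: R] (fun p => (phi (p / L))%:E).
Proof.
apply/measurable_EFinP; apply: (measurableT_comp mphi).
exact: mulrr_measurable.
Qed.

Let integral_phi_rcdf :
  (\int[U]_p (phi (p / L))%:E = \int[P]_t (phi (F (X t) / L))%:E)%E.
Proof.
rewrite -(integral_rcdf_comp (X := X) (f := fun p => (phi (p / L))%:E))//.
  exact: rcdf_continuous.
by move=> x; rewrite lee_fin.
Qed.

Let mphiF : measurable_fun [set: T] (fun t => (phi (F (X t) / L))%:E).
Proof. exact: measurableT_comp mphiL (measurable_rcdf_comp X). Qed.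

(** Here F 0 = 0, so F(X) <= L X by the Lipschitz bound, and F(X) is
    uniform. *)
Lemma integral_ge_uniform : (forall t, 0 <= X t) ->
  (\int[U]_p (phi (p / L))%:E <= \int[P]_t (phi (X t))%:E)%E.
Proof.
move=> X0.
have F0 : F 0 = 0.
  apply/le_anti; rewrite rcdf_ge0 andbT -lee_fin -PX_le.
  rewrite [leRHS](_ : _ = (L * (0 - 0))%:E); last by rewrite subr0 mulr0.
  apply: le_trans (density (lexx 0)).
  apply: le_measure; rewrite ?inE// => t /=.
  by rewrite !in_itv/= X0.
rewrite integral_phi_rcdf; apply: ge0_le_integral => //.
- by move=> t _; rewrite lee_fin.
- move=> t _; rewrite lee_fin; apply: phi_mono.
  rewrite normrM normfV (gtr0_norm L_gt0) ler_pdivrMr//.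
  have := rcdf_lipschitz 0 (X t); rewrite F0 !subr0 => /le_trans; apply.
  by rewrite mulrC.
Qed.

Lemma integral_eq_uniform : P (X @^-1` `[0, L^-1]) = 1%E ->
  (\int[P]_t (phi (X t))%:E = \int[U]_p (phi (p / L))%:E)%E.
Proof.
move=> P1; rewrite integral_phi_rcdf; apply: ge0_ae_eq_integral => //.
- by move=> t _; rewrite lee_fin.
- by move=> t _; rewrite lee_fin.
- apply: (probability1_ae _ P1) => // t /=; rewrite in_itv/= => tL _.
  rewrite (@rcdf_affine 0 L^-1)//; first by rewrite subr0 mulrC mulKf// gt_eqF.
  by rewrite subr0 divff// gt_eqF.
Qed.

Let mphi2 d' (S : measurableType d') (f : S -> R) (c : R) :
  measurable_fun [set: S] f ->
  measurable_fun [set: S * S] (fun z => (phi ((f z.2 - f z.1) * c))%:E).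
Proof.
move=> mf; apply/measurable_EFinP; apply: (measurableT_comp mphi).
apply: measurable_funM => //; apply: measurable_funB.
  exact: measurableT_comp mf measurable_snd.
exact: measurableT_comp mf measurable_fst.
Qed.

Let mphi2X : measurable_fun [set: T * T]
  (fun z => (phi (X z.2 - X z.1))%:E).
Proof.
under eq_fun do rewrite -[_ - _]mulr1.
by apply: mphi2; exact: measurable_funPT.
Qed.

Let mphi2F : measurable_fun [set: T * T]
  (fun z => (phi ((F (X z.2) - F (X z.1)) / L))%:E).
Proof. exact: mphi2 (measurable_rcdf_comp X). Qed.

Let mintX : measurable_fun [set: T]
  (fun s => \int[P]_t (phi (X t - X s))%:E)%E.
Proof.
have := @measurable_fun_fubini_tonelli_F _ _ T T R P _ mphi2X.
by apply => z; rewrite lee_fin.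
Qed.

Let mintF : measurable_fun [set: T]
  (fun s => \int[P]_t (phi ((F (X t) - F (X s)) / L))%:E)%E.
Proof.
have := @measurable_fun_fubini_tonelli_F _ _ T T R P _ mphi2F.
by apply => z; rewrite lee_fin.
Qed.

Let integral2_phi_rcdf :
  (\int[U]_p \int[U]_q (phi ((q - p) / L))%:E =
   \int[P]_s \int[P]_t (phi ((F (X t) - F (X s)) / L))%:E)%E.
Proof.
pose g (z : measurableTypeR R * measurableTypeR R) := (phi ((z.2 - z.1) / L))%:E.
have mg : measurable_fun setT g.
  by apply: (@mphi2 _ (measurableTypeR R) idfun L^-1); exact: measurable_id.
have g0 z : (0 <= g z)%E by rewrite lee_fin.
rewrite -(integral_rcdf_comp (X := X) (f := fubini_F U g)).
- apply: eq_integral => s _.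
  apply/esym/(integral_rcdf_comp (X := X) (f := fun q => g (F (X s), q))) => //.
    exact: rcdf_continuous.
  exact: (measurableT_comp mg).
- exact: rcdf_continuous.
- exact: measurable_fun_fubini_tonelli_F.
- by move=> x; apply: integral_ge0.
Qed.

(** F contracts distances, up to the factor L, and maps two independent copies
    of X to two independent uniform variables. *)
Lemma integral2_ge_uniform :
  (\int[U]_p \int[U]_q (phi ((q - p) / L))%:E <=
   \int[P]_s \int[P]_t (phi (X t - X s))%:E)%E.
Proof.
rewrite integral2_phi_rcdf; apply: ge0_le_integral => //.
- by move=> s _; apply: integral_ge0 => t _; rewrite lee_fin.
- move=> s _; apply: ge0_le_integral => //.
  + by move=> t _; rewrite lee_fin.
  + exact: measurableT_comp mphi2F (pair1_measurable s).
  + exact: measurableT_comp mphi2X (pair1_measurable s).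
  + move=> t _; rewrite lee_fin; apply: phi_mono.
    by rewrite normrM normfV (gtr0_norm L_gt0) ler_pdivrMr// mulrC rcdf_lipschitz.
Qed.

(** F is affine on [a, b] with slope L, so the contraction used for the lower
    bound is a similarity on almost all values of X. *)
Lemma integral2_eq_uniform a b : L * (b - a) = 1 ->
  P (X @^-1` `[a, b]) = 1%E ->
  (\int[P]_s \int[P]_t (phi (X t - X s))%:E =
   \int[U]_p \int[U]_q (phi ((q - p) / L))%:E)%E.
Proof.
move=> Lab P1; rewrite integral2_phi_rcdf; apply: ge0_ae_eq_integral => //.
- by move=> s _; apply: integral_ge0 => t _; rewrite lee_fin.
- by move=> s _; apply: integral_ge0 => t _; rewrite lee_fin.
- apply: (probability1_ae _ P1) => // s /=; rewrite in_itv/= => sab _.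
  apply: ge0_ae_eq_integral => //.
  + exact: measurableT_comp mphi2X (pair1_measurable s).
  + exact: measurableT_comp mphi2F (pair1_measurable s).
  + by move=> t _; rewrite lee_fin.
  + by move=> t _; rewrite lee_fin.
  + apply: (probability1_ae _ P1) => // t /=; rewrite in_itv/= => tab _.
    rewrite (rcdf_affine Lab P1 sab) (rcdf_affine Lab P1 tab).
    by rewrite -mulrBr mulrC mulKf ?gt_eqF// opprB addrA subrK.
Qed.

End bounded_density.

(** * The discrepancy function and the centered points *)

(** The counting function is the rounding of y to a nearest integer. By
    induction: for y <= N the last point does not count, and for y > N all
    earlier points do. *)
Lemma count_centered (R : realType) (N : nat) (y : R) :
  0 <= y -> y <= N%:R ->
  `|\sum_(i < N) (i%:R + 2^-1 < y)%R%:R - y| <= 2^-1.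
Proof.
elim: N => [|N IH] y0 yN.
  by rewrite big_ord0 sub0r normrN ger0_norm//; lra.
rewrite big_ord_recr/=; have [yN'|Ny] := leP y N%:R.
  rewrite ltNge (_ : y <= _)//=; last lra.
  by rewrite addr0; exact: IH.
rewrite (eq_bigr (fun=> 1)) => [|i _]; last first.
  suff -> : (i%:R + 2^-1 < y)%R by [].
  have : i.+1%:R <= N%:R :> R by rewrite ler_nat.
  by rewrite -natr1; lra.
rewrite sumr_const card_ord -natr1 in yN *.
by case: ltP => /= ?; rewrite ler_norml; apply/andP; split; lra.
Qed.

Definition centered_points (R : realType) (N : nat) : {fset R} :=
  [fset ((i : nat)%:R + 2^-1) / N%:R | i : 'I_N in 'I_N]%fset.

Section centered.
Variables (R : realType) (N : nat).
Hypothesis N_gt0 : (0 < N)%N.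

Let N_gt0R : 0 < N%:R :> R. Proof. by rewrite ltr0n. Qed.

Let inj : injective (fun i : 'I_N => (i%:R + 2^-1) / N%:R : R).
Proof.
move=> i j /(mulIf (invr_neq0 (lt0r_neq0 N_gt0R)))/addIr/eqP.
by rewrite eqr_nat => /eqP/val_inj.
Qed.

Lemma card_centered_points : #|` centered_points R N| = N.
Proof. by rewrite card_imfset//= -cardE card_ord. Qed.

Lemma centered_points_itv : [set` centered_points R N] `<=` `[0, 1].
Proof.
move=> x /= /imfsetP[i _ ->]; rewrite in_itv/=.
have : i.+1%:R <= N%:R :> R by rewrite ler_nat.
rewrite divr_ge0//=.
rewrite ler_pdivrMr// -natr1; lra.
Qed.

Lemma discrepancy_centered_points (t : R) : 0 <= t -> t <= 1 ->
  `|discrepancy (centered_points R N) t| <= 2^-1.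
Proof.
move=> t0 t1; rewrite /discrepancy card_centered_points.
rewrite eq_big_imfset/=; last by move=> i j _ _ /inj.
rewrite big_map big_enum/=.
rewrite (eq_bigr (fun i : 'I_N => (i%:R + 2^-1 < N%:R * t)%R%:R)).
  by apply: count_centered; rewrite ?mulr_ge0// ler_piMr.
move=> i _; rewrite indicE mem_setE in_itv/= divr_ge0//=.
by rewrite ltr_pdivrMr// [t * _]mulrC.
Qed.

End centered.

Section law.
Variables (R : realType) (P : {fset R}).
Local Notation mu := (@lebesgue_measure R).

Lemma measurable_discrepancy : measurable_fun [set: R] (discrepancy P).
Proof.
rewrite /discrepancy; apply: measurable_funB.
  apply: measurable_sum => x.
  rewrite (_ : (fun t : R => _) = \1_(if 0 <= x then `]x, +oo[%classic else set0)).
    by apply: measurable_indic; case: ifP.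
  by apply/funext => t; rewrite !indicE; congr (_%:R);
    case: ifP => x0; rewrite ?in_set0 mem_setE in_itv/= ?x0// mem_setE in_itv/= andbT.
exact: mulrl_measurable.
Qed.

Hypothesis P_gt0 : (0 < #|` P|)%N.
Let N := #|` P|.

Lemma discrepancy_count (t : R) :
  exists2 k, (k <= N)%N & discrepancy P t = k%:R - N%:R * t.
Proof.
exists (\sum_(x <- P) (x \in `[0%R, t[%classic))%N.
  rewrite /N -sum1_size; apply: leq_sum => x _; exact: leq_b1.
rewrite /discrepancy natr_sum; congr (_ - _).
Qed.

(** On the part of [0, 1] where exactly k points lie to the left of t, the
    value u <= D <= v confines t to an interval of length (v - u) / N. There
    are N + 1 such parts, but those of k = 0 and k = N are cut off by the ends
    of [0, 1] in complementary ways and cost only (v - u) / N together. *)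
Lemma discrepancy_density (u v : R) : u <= v ->
  (mu (`[0%R, 1%R] `&` discrepancy P @^-1` `[u, v]) <= (v - u)%:E)%E.
Proof.
move=> uv.
have N0 : 0 < N%:R :> R by rewrite ltr0n.
have [M NM] : exists M, N = M.+1 by exists N.-1; rewrite prednK.
(* [c k w] is where k - N t = w on the k-th part, clipped to [0, 1] at the
   two outer parts only. *)
pose c k w : R := if k == 0%N then Num.max 0 (- w / N%:R)
  else if k == N then Num.min 1 (1 - w / N%:R) else (k%:R - w) / N%:R.
pose J k := `[c k v, c k u]%classic.
have uvN : u / N%:R <= v / N%:R by rewrite ler_pM2r ?invr_gt0.
have cuv k : c k v <= c k u.
  rewrite /c; case: ifP => _; last case: ifP => _; last first.
  - by rewrite ler_pM2r ?invr_gt0//; lra.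
  - by rewrite /Num.min; do 2! case: ifPn; rewrite -?leNgt; lra.
  - rewrite !mulNr /Num.max; do 2! case: ifPn; rewrite -?leNgt; lra.
(* The clippings at 0 and at 1 cancel in the sum, since
   max(0, x) + min(1, 1 + x) = 1 + x. *)
have csum w : \sum_(k < N.+1) c k w =
    1 - w / N%:R + \sum_(k < M) (k.+1%:R - w) / N%:R.
  rewrite NM big_ord_recl big_ord_recr/= addrCA addrC; congr (_ + _).
    rewrite /c/= NM/= eqxx mulNr /Num.min /Num.max; set q := w / _.
    by do 2! case: ifPn; rewrite -?leNgt; lra.
  apply: eq_bigr => k _; rewrite /c/= NM /bump/= add1n eqSS.
  by rewrite ltn_eqF.
apply: (@le_trans _ _ (mu (\big[setU/set0]_(k < N.+1) J k))).
  apply: le_measure; rewrite ?inE.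
  - apply: measurableI => //.
    by rewrite -[X in measurable X]setTI; exact: measurable_discrepancy.
  - by apply: bigsetU_measurable => k _; exact: measurable_itv.
  - move=> t /= [+ ]; rewrite !in_itv/= => /andP[t0 t1].
    have [k kN ->] := discrepancy_count t => /andP[ut tv].
    rewrite -bigcup_mkord; exists k => //=; rewrite /J/= in_itv/= /c.
    have lo : (k%:R - v) / N%:R <= t by rewrite ler_pdivrMr//; lra.
    have hi : t <= (k%:R - u) / N%:R by rewrite ler_pdivlMr//; lra.
    case: eqP => [k0|_]; last case: eqP => [kN'|_]; last by rewrite lo.
    + by move: lo hi; rewrite k0 !sub0r ge_max le_max t0 => -> ->; rewrite orbT.
    + move: lo hi; rewrite kN' !mulrBl divff ?lt0r_neq0// ge_min le_min t1.
      by move=> -> ->; rewrite orbT.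
apply: le_trans (Boole_inequality _ _) _ => [k _|]; first exact: measurable_itv.
rewrite (eq_bigr (fun k : 'I_N.+1 => (c k u - c k v)%:E)); last first.
  move=> k _ /=; rewrite /J lebesgue_measure_itv/= lte_fin.
  by have := cuv k; rewrite le_eqVlt => /predU1P[->|->//]; rewrite ltxx subrr.
rewrite sumEFin lee_fin big_split/= sumrN !csum.
rewrite opprD addrACA -sumrB.
rewrite (eq_bigr (fun=> (v - u) / N%:R)); last by move=> k _; lra.
rewrite sumr_const card_ord -mulr_natl.
have -> : N%:R = M%:R + 1 :> R by rewrite NM -natr1.
by rewrite le_eqVlt; apply/orP; left; apply/eqP; field; rewrite natr1 pnatr_eq0.
Qed.

End law.

(** * Laws of the discrepancy at a uniform point *)

Section uniform_random_variables.
Variable R : realType.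
Local Notation U := (@uniform_prob R 0 1 ltr01).

Definition discrepancy_rv (P : {fset R}) : measurableTypeR R -> R :=
  discrepancy P.

HB.instance Definition _ (P : {fset R}) :=
  @isMeasurableFun.Build _ _ (measurableTypeR R) R (discrepancy_rv P)
    (measurable_discrepancy P).

Definition abs_discrepancy_rv (P : {fset R}) : measurableTypeR R -> R :=
  fun t => `|discrepancy P t|.

Lemma measurable_abs_discrepancy_rv (P : {fset R}) :
  measurable_fun setT (abs_discrepancy_rv P).
Proof.
exact: measurableT_comp (@normr_measurable R setT) (measurable_discrepancy P).
Qed.

HB.instance Definition _ (P : {fset R}) :=
  @isMeasurableFun.Build _ _ (measurableTypeR R) R (abs_discrepancy_rv P)
    (measurable_abs_discrepancy_rv P).

Lemma uniform_prob_discrepancy (P : {fset R}) (u v : R) :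
  (0 < #|` P|)%N -> u <= v ->
  (U (discrepancy_rv P @^-1` `[u, v]) <= (1 * (v - u))%:E)%E.
Proof.
move=> P0 uv; rewrite uniform_prob01E; last exact: measurable_funPTI.
by rewrite mul1r setIC; exact: discrepancy_density.
Qed.

Lemma uniform_prob_abs_discrepancy (P : {fset R}) (u v : R) :
  (0 < #|` P|)%N -> u <= v ->
  (U (abs_discrepancy_rv P @^-1` `[u, v]) <= (2 * (v - u))%:E)%E.
Proof.
move=> P0 uv.
have mA i : measurable (abs_discrepancy_rv P @^-1` [set` i : interval R]).
  exact: measurable_funPTI.
have mD i : measurable (discrepancy_rv P @^-1` [set` i : interval R]).
  exact: measurable_funPTI.
have [u0|u0] := leP 0 u.
  apply: (@le_trans _ _ (U (discrepancy_rv P @^-1` `[u, v] `|`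
                            discrepancy_rv P @^-1` `[- v, - u]))).
    apply: le_measure; rewrite ?inE//; first exact: measurableU.
    move=> t /=; rewrite !in_itv/= /abs_discrepancy_rv /discrepancy_rv.
    by case: (ger0P (discrepancy P t)) => ? /andP[? ?]; [left|right];
      apply/andP; split; lra.
  apply: le_trans (measureU2 _ _ _) _ => //.
  have -> : 2 * (v - u) = 1 * (v - u) + 1 * (- u - - v) by ring.
  rewrite EFinD; apply: leeD; apply: uniform_prob_discrepancy => //.
  by rewrite lerN2.
have [v0|v0] := leP 0 v; last first.
  rewrite (_ : _ @^-1` _ = set0) ?measure0.
    by rewrite lee_fin mulr_ge0// subr_ge0.
  apply/seteqP; split=> t //=; rewrite in_itv/= => /andP[_].
  by rewrite leNgt (lt_le_trans v0 (normr_ge0 _)).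
apply: (@le_trans _ _ (U (discrepancy_rv P @^-1` `[- v, v]))).
  apply: le_measure; rewrite ?inE// => t /=.
  by rewrite !in_itv/= => /andP[_]; rewrite ler_norml.
apply: le_trans (uniform_prob_discrepancy P0 _) _; first lra.
by rewrite lee_fin; lra.
Qed.

Lemma uniform_prob_eq1 (a b : R) (X : {mfun measurableTypeR R >-> R}) :
  (forall t, 0 <= t <= 1 -> a <= X t <= b) -> U (X @^-1` `[a, b]) = 1%E.
Proof.
move=> Xab; rewrite uniform_prob01E; last exact: measurable_funPTI.
rewrite setIidr; last by move=> t /=; rewrite !in_itv/=; exact: Xab.
by rewrite lebesgue_measure_itv/= lte_fin ltr01 oppr0 adde0.
Qed.

Lemma integral2_uniform01 (f : measurableTypeR R * measurableTypeR R -> \bar R) :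
  measurable_fun setT f -> (forall z, 0 <= f z)%E ->
  (\int[@lebesgue_measure R \x @lebesgue_measure R]_(z in
      `[0%R, 1%R]%classic `*` `[0%R, 1%R]%classic) f z =
   \int[U]_s \int[U]_t f (s, t))%E.
Proof.
move=> mf f0.
have mI : measurable (`[0, 1]%classic : set (measurableTypeR R)) by [].
rewrite integral_mkcond fubini_tonelli1; last 2 first.
- apply/(measurable_restrictT f); first exact: measurableX.
  exact: measurable_funTS.
- by move=> z; rewrite erestrict_ge0.
rewrite integral_uniform01; last 2 first.
- exact: (@measurable_fun_fubini_tonelli_F _ _ _ _ R U f mf f0).
- by move=> s; apply: integral_ge0 => t _.
rewrite [RHS]integral_mkcond; apply: eq_integral => s _.
rewrite /fubini_F patchE; case: ifPn => sI.
  rewrite integral_uniform01//; last exact: measurableT_comp mf (pair1_measurable s).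
  rewrite [RHS]integral_mkcond; apply: eq_integral => t _.
  by rewrite !patchE in_setX/= sI.
by apply: integral0_eq => t _; rewrite patchE in_setX/= (negbTE sI).
Qed.

End uniform_random_variables.

(** * The extremal integrals *)

Section model_integrals.
Variables (R : realType) (psi Psi T : R -> R).
Local Notation U := (@uniform_prob R 0 1 ltr01).
Hypothesis psi_ge0 : forall x : R, 0 <= x -> 0 <= psi x.
Hypothesis psi_ac : forall a : R, 0 <= a -> abs_continuous_on 0 a psi.
Hypothesis Psi_ge0 : forall x : R, 0 <= x -> 0 <= Psi x.
Hypothesis Psi0 : Psi 0 = 0.
Hypothesis T0 : T 0 = 0.
Hypothesis dPsi : has_derivative_nonneg Psi psi.
Hypothesis dT : has_derivative_nonneg T Psi.
Variable K : R.
Hypothesis K_gt0 : 0 < K.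

Let phi (x : R) := psi (`|x| / K).

Lemma even_scaled_continuous : continuous phi.
Proof.
move=> x; rewrite /phi.
have -> : (fun x => psi (`|x| / K)) = (fun x : R => psi `|x|) \o (fun x => x / K).
  by apply/funext => y /=; rewrite normrM normfV (gtr0_norm K_gt0).
apply: continuous_comp; last exact: even_continuous.
exact: mulrr_continuous.
Qed.

Let phiE x : phi x = psi `|x / K|.
Proof. by rewrite /phi normrM normfV (gtr0_norm K_gt0). Qed.

Let mphi : measurable_fun [set: R] phi.
Proof. exact: continuous_measurable_fun even_scaled_continuous. Qed.

Let phi_ge0 x : 0 <= phi x.
Proof. by rewrite phiE psi_ge0. Qed.

Let dPsio := is_derive_odd_extension Psi0 dPsi.
Let dTo := is_derive_odd_extension T0 dT.

Let odd_extensionE (F : R -> R) x : F 0 = 0 -> 0 <= x -> odd_extension F x = F x.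
Proof.
move=> F0; rewrite le_eqVlt => /predU1P[<-|x0].
  by rewrite /odd_extension sgr0 mul0r F0.
by rewrite /odd_extension gtr0_sg// gtr0_norm// mul1r.
Qed.

Let odd_extensionN (F : R -> R) x : odd_extension F (- x) = - odd_extension F x.
Proof. by rewrite /odd_extension sgrN normrN mulNr. Qed.

(** The antiderivative of psi(|p| / (2 K)) is the odd extension of Psi,
    rescaled. *)
Lemma integral_uniform_dist0 :
  (\int[U]_p (phi (p / 2))%:E = (2 * K * Psi (1 / (2 * K)))%:E)%E.
Proof.
rewrite integral_uniform01; last 2 first.
- apply/measurable_EFinP; apply: (measurableT_comp mphi).
  exact: mulrr_measurable.
- by move=> x; rewrite lee_fin.
have K2 : 2 * K != 0 by rewrite mulf_neq0// gt_eqF.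
have dF (x : R) : is_derive x 1
    (fun p => 2 * K * odd_extension Psi ((2 * K)^-1 * p + 0)) (phi (x / 2)).
  have := @is_derive_affine _ _ _ (2 * K)^-1 0 (2 * K) dPsio x.
  rewrite mulrA divff// mul1r addr0 phiE.
  by have -> : (2 * K)^-1 * x = x / 2 / K by rewrite invfM; ring.
have cphi : continuous (fun p : R => phi (p / 2)).
  move=> x; apply: continuous_comp; last exact: even_scaled_continuous.
  exact: mulrr_continuous.
rewrite (integral_derivative ltr01 cphi dF).
rewrite !addr0 mulr1 mulr0 {2}/odd_extension sgr0 mul0r mulr0 subr0 div1r.
by rewrite odd_extensionE// invr_ge0 mulr_ge0// ltW.
Qed.

(** The values of Psi keep their absolute values so that the right-hand side is
    continuous in p on the whole line. *)
Lemma integral_dist p : 0 <= p <= 1 ->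
  (\int[lebesgue_measure]_(q in `[0%R, 1%R]) (phi (q - p))%:E =
    (K * (Psi `|(1 - p) / K| + Psi `|p / K|))%:E)%E.
Proof.
move=> /andP[p0 p1].
have KN0 : K != 0 by rewrite gt_eqF.
have dF (x : R) : is_derive x 1
    (fun q => K * odd_extension Psi (K^-1 * q + - (p / K))) (phi (x - p)).
  have := @is_derive_affine _ _ _ K^-1 (- (p / K)) K dPsio x.
  rewrite mulrA divff// mul1r phiE.
  by have -> : K^-1 * x + - (p / K) = (x - p) / K by ring.
have cphi : continuous (fun q : R => phi (q - p)).
  move=> x; apply: continuous_comp; last exact: even_scaled_continuous.
  by apply: cvgB; [exact: cvg_id|exact: cvg_cst].
rewrite (integral_derivative ltr01 cphi dF).
rewrite mulr0 sub0r odd_extensionN mulr1.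
have -> : K^-1 - p / K = (1 - p) / K by ring.
rewrite !odd_extensionE ?divr_ge0 ?subr_ge0// ?(ltW K_gt0)//.
by rewrite !ger0_norm ?divr_ge0 ?subr_ge0// ?(ltW K_gt0)//; congr EFin; ring.
Qed.

Let Psi_abs_continuous : continuous (fun x : R => Psi `|x|).
Proof.
have -> : (fun x : R => Psi `|x|) = (fun x => `|odd_extension Psi x|).
  apply/funext => x; rewrite /odd_extension normrM.
  have [->|x0] := eqVneq x 0; first by rewrite normr0 sgr0 normr0 mul0r Psi0.
  by rewrite normr_sg x0 mul1r ger0_norm// Psi_ge0.
move=> x; apply: continuous_comp; last exact: norm_continuous.
by apply/differentiable_continuous/derivable1_diffP; case: (dPsio x).
Qed.

(** Integrating psi(|q - p| / K) over q leaves two values of Psi, one for each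
    end of [0, 1]; each contributes one term K^2 T(1 / K) after integration
    over p. *)
Lemma integral2_uniform_dist :
  (\int[U]_p \int[U]_q (phi ((q - p) / 1))%:E = (2 * K ^+ 2 * T (1 / K))%:E)%E.
Proof.
have KN0 : K != 0 by rewrite gt_eqF.
have mphi2 : measurable_fun [set: measurableTypeR R * measurableTypeR R]
    (fun z => (phi ((z.2 - z.1) / 1))%:E).
  apply/measurable_EFinP; apply: (measurableT_comp mphi).
  apply: measurable_funM => //; apply: measurable_funB.
    exact: measurable_snd.
  exact: measurable_fst.
rewrite integral_uniform01; last 2 first.
- apply: (@measurable_fun_fubini_tonelli_F _ _ _ _ R U _ mphi2) => z.
  by rewrite lee_fin.
- by move=> p; apply: integral_ge0 => q _; rewrite lee_fin.
transitivity (\int[lebesgue_measure]_(p in `[0%R, 1%R])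
    (K * (Psi `|(1 - p) / K| + Psi `|p / K|))%:E)%E.
  apply: eq_integral.
  move=> p; rewrite inE/= in_itv/= => p01.
  rewrite integral_uniform01; last 2 first.
  - exact: measurableT_comp mphi2 (pair1_measurable p).
  - by move=> q; rewrite lee_fin.
  rewrite -integral_dist//; apply: eq_integral => q _.
  by rewrite divr1.
have dF (x : R) : is_derive x 1
    (fun p => K ^+ 2 * odd_extension T (K^-1 * p + 0)
            + - K ^+ 2 * odd_extension T (- K^-1 * p + K^-1))
    (K * (Psi `|(1 - x) / K| + Psi `|x / K|)).
  have dL := @is_derive_affine _ _ _ K^-1 0 (K ^+ 2) dTo x.
  have dR := @is_derive_affine _ _ _ (- K^-1) K^-1 (- K ^+ 2) dTo x.
  apply: is_derive_eq.
  have -> : K^-1 * x + 0 = x / K by ring.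
  have -> : - K^-1 * x + K^-1 = (1 - x) / K by ring.
  by field.
have cPsi_comp (g : R -> R) : continuous g -> continuous (fun x => Psi `|g x|).
  move=> cg x; apply: (@continuous_comp _ _ _ g (fun y : R => Psi `|y|)).
    exact: cg.
  exact: Psi_abs_continuous.
have cPsi : continuous
    (fun x : R => K * (Psi `|(1 - x) / K| + Psi `|x / K|)).
  have c1 : continuous (fun x : R => Psi `|(1 - x) / K|).
    apply: (cPsi_comp (fun x => (1 - x) / K)) => y.
    by apply: cvgM; [apply: cvgB; [exact: cvg_cst|exact: cvg_id]|exact: cvg_cst].
  have c2 : continuous (fun x : R => Psi `|x / K|).
    by apply: (cPsi_comp (fun x => x / K)) => y; exact: mulrr_continuous.
  by move=> x; apply: cvgM; [exact: cvg_cst|apply: cvgD; [exact: c1|exact: c2]].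
rewrite (integral_derivative ltr01 cPsi dF).
rewrite !mulr1 !mulr0 !addr0 addNr add0r.
have To0 : odd_extension T 0 = 0 by rewrite odd_extensionE.
rewrite To0 !odd_extensionE ?invr_ge0 ?(ltW K_gt0)// div1r.
by congr EFin; ring.
Qed.

End model_integrals.

(** * Infima of norms *)

(** Attainment by one index at every level K at once is what allows the two
    infima to be exchanged without loss. *)
Lemma ereal_inf_level_attained (R : realType) (I : Type) (S : set I)
    (f : I -> R -> \bar R) (g : R -> R) (i0 : I) :
  S i0 -> (forall i K, S i -> 0 < K -> ((g K)%:E <= f i K)%E) ->
  (forall K, 0 < K -> f i0 K = (g K)%:E) ->
  ereal_inf [set ereal_inf [set K%:E | K in
                   [set K : R | 0 < K /\ (f i K <= 1)%E]] | i in S]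
  = ereal_inf [set K%:E | K in [set K : R | 0 < K /\ g K <= 1]].
Proof.
move=> Si0 gf fi0; apply/le_anti/andP; split.
- apply: ereal_inf_lbound; exists i0 => //; congr ereal_inf.
  apply/seteqP; split=> _ [K [K0 le1] <-]; exists K => //.
    by move: le1; rewrite fi0// lee_fin.
  by split=> //; rewrite fi0// lee_fin.
- apply: le_ereal_inf_tmp => _ [i Si <-].
  apply: ereal_inf_le_tmp => _ [K [K0 le1] <-]; exists K => //; split=> //.
  by rewrite -lee_fin; apply: le_trans (gf i K Si K0) le1.
Qed.

Theorem corollary4p2 (R : realType) (psi Psi T : R -> R) (N : nat)
  (psi_ge0 : forall x : R, 0 <= x -> 0 <= psi x)
  (psi_ac : forall a : R, 0 <= a -> abs_continuous_on 0 a psi)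
  (psi_incr : forall x y : R, 0 <= x -> x < y -> psi x < psi y)
  (psi0 : psi 0 = 0)
  (Psi_ge0 : forall x : R, 0 <= x -> 0 <= Psi x)
  (T_ge0 : forall x : R, 0 <= x -> 0 <= T x)
  (Psi0 : Psi 0 = 0)
  (T0 : T 0 = 0)
  (dPsi : has_derivative_nonneg Psi psi)
  (dT : has_derivative_nonneg T Psi)
  (N_gt0 : (0 < N)%N) :
  ereal_inf [set psi_norm (@lebesgue_measure R) `[0, 1]%classic psi (discrepancy P)
            | P in @point_sets R N]
    = ereal_inf [set K%:E | K in
        [set K : R | 0 < K /\ 2 * K * Psi (1 / (2 * K)) <= 1]]
  /\
  ereal_inf [set psi_norm (@lebesgue_measure R \x @lebesgue_measure R)%E
                          (`[0, 1]%classic `*` `[0, 1]%classic) psi (discrepancy2 P)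
            | P in @point_sets R N]
    = ereal_inf [set K%:E | K in
        [set K : R | 0 < K /\ 2 * K ^+ 2 * T (1 / K) <= 1]].
Proof.
pose U := @uniform_prob R 0 1 ltr01.
have C_N : point_sets N (centered_points R N).
  by split; [exact: card_centered_points|exact: centered_points_itv].
have P_gt0 P : point_sets N P -> (0 < #|` P|)%N by move=> [-> _].
pose phi K (x : R) := psi (`|x| / K).
have phi_ge0 K : 0 < K -> forall x, 0 <= phi K x.
  by move=> K0 x; rewrite psi_ge0// divr_ge0// ltW.
have phi_mono K : 0 < K -> forall x y, `|x| <= `|y| -> phi K x <= phi K y.
  move=> K0 x y; rewrite le_eqVlt /phi => /predU1P[->//|xy]; apply: ltW.
  by apply: psi_incr; [rewrite divr_ge0// ltW|rewrite ltr_pM2r// invr_gt0].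
have mphi K : 0 < K -> measurable_fun [set: R] (phi K).
  by move=> K0; exact: continuous_measurable_fun (even_scaled_continuous _ _).
have one_parameterE P K : 0 < K ->
    (\int[lebesgue_measure]_(t in `[0%R, 1%R]) (psi (`|discrepancy P t| / K))%:E
     = \int[U]_t (phi K (abs_discrepancy_rv P t))%:E)%E.
  move=> K0; rewrite integral_uniform01; last 2 first.
  - apply/measurable_EFinP; apply: (measurableT_comp (mphi _ K0)).
    exact: measurable_abs_discrepancy_rv.
  - by move=> t; rewrite lee_fin phi_ge0.
  by apply: eq_integral => t _; rewrite /phi/= /abs_discrepancy_rv normr_id.
have two_parameterE P K : 0 < K ->
    (\int[@lebesgue_measure R \x @lebesgue_measure R]_(z in
       `[0%R, 1%R]%classic `*` `[0%R, 1%R]%classic)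
       (psi (`|discrepancy2 P z| / K))%:E
     = \int[U]_s \int[U]_t
         (phi K (discrepancy_rv P t - discrepancy_rv P s))%:E)%E.
  move=> K0; rewrite integral2_uniform01//.
    apply/measurable_EFinP; apply: (measurableT_comp (mphi _ K0)).
    apply: measurable_funB.
      exact: measurableT_comp (measurable_discrepancy P) measurable_snd.
    exact: measurableT_comp (measurable_discrepancy P) measurable_fst.
  by move=> z; rewrite lee_fin; exact: phi_ge0.
have centered_le t : 0 <= t <= 1 -> `|discrepancy (centered_points R N) t| <= 2^-1.
  by move=> /andP[t0 t1]; exact: discrepancy_centered_points.
split; apply: (ereal_inf_level_attained C_N) => [P K /P_gt0 P0 K0|K K0].
- rewrite one_parameterE// -(integral_uniform_dist0 psi_ge0 psi_ac Psi0 dPsi K0).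
  apply: integral_ge_uniform => //; [|exact: phi_ge0|exact: phi_mono|exact: mphi|].
    by move=> u v; exact: uniform_prob_abs_discrepancy.
  by move=> t; exact: normr_ge0.
- rewrite one_parameterE// -(integral_uniform_dist0 psi_ge0 psi_ac Psi0 dPsi K0).
  apply: integral_eq_uniform => //; [|exact: phi_ge0|exact: mphi|].
    by move=> u v; apply: uniform_prob_abs_discrepancy; exact: P_gt0.
  apply: uniform_prob_eq1 => t t01.
  by rewrite normr_ge0; exact: centered_le.
- rewrite two_parameterE//.
  rewrite -(integral2_uniform_dist psi_ge0 psi_ac Psi_ge0 Psi0 T0 dPsi dT K0).
  apply: integral2_ge_uniform => //; [|exact: phi_ge0|exact: phi_mono|exact: mphi].
  by move=> u v; exact: uniform_prob_discrepancy.
- rewrite two_parameterE//.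
  rewrite -(integral2_uniform_dist psi_ge0 psi_ac Psi_ge0 Psi0 T0 dPsi dT K0).
  apply: (@integral2_eq_uniform _ _ _ _ _ _ _ _ _ _ _ (- 2^-1) 2^-1) => //.
  + by move=> u v; apply: uniform_prob_discrepancy; exact: P_gt0.
  + exact: phi_ge0.
  + exact: mphi.
  + lra.
  + by apply: uniform_prob_eq1 => t /centered_le; rewrite ler_norml.
Qed.
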